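(* Let $P(z)\in\mathbb{C}[[z]]$ be Hessian nilpotent. For $k\ge 0$ and $\alpha\ge 1$ set $$u_{k,\alpha}(P)=\frac{\alpha!}{2^k\,k!\,(k+\alpha)!}\,\Delta^kP^{k+\alpha}.$$ Then for any integers $\alpha,\beta\ge 1$ and $m\ge 0$, $$u_{m,\alpha+\beta}(P)=\sum_{\substack{k+l=m\\k,l\ge 0}}u_{k,\alpha}(P)\,u_{l,\beta}(P).$$ More explicitly, $$\Delta^mP^{m+\alpha+\beta}=\binom{\alpha+\beta}{\alpha}^{-1}\sum_{\substack{k+l=m\\k,l\ge 0}}\binom mk\binom{m+\alpha+\beta}{k+\alpha}\left(\Delta^kP^{k+\alpha}\right)\left(\Delta^lP^{l+\beta}\right).$$
   Context: $z=(z_1,\dots,z_n)$ and $\Delta=\sum_{i=1}^n \partial^2/\partial z_i^2$. $P$ is Hessian nilpotent if its Hessian matrix $\left(\frac{\partial^2 P}{\partial z_i\partial z_j}\right)$ is nilpotent. *)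

(* Defs.v *)
From HB Require Import structures.
From mathcomp Require Import all_boot all_order all_algebra.
From mathcomp Require Import mpoly.
From mathcomp Require Import boolp reals complex.

Set Implicit Arguments.
Unset Strict Implicit.
Unset Printing Implicit Defensive.

Import GRing.Theory.
Local Open Scope ring_scope.

(* R[[z_1, ..., z_n]]: arbitrary families of coefficients indexed by the      *)
(* exponents 'X_{1..n} of mpoly. A record rather than a bare function type,   *)
(* so that the Cauchy product below does not meet the pointwise product.      *)
Record mfps (n : nat) (R : Type) := MFPS { fcoef : 'X_{1..n} -> R }.

Arguments MFPS {n R}.
Arguments fcoef {n R}.

HB.instance Definition _ (n : nat) (R : choiceType) :=
  [isNew for @fcoef n R].
HB.instance Definition _ (n : nat) (R : choiceType) :=
  [Choice of mfps n R by <:].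

Lemma mfpsP (n : nat) (R : Type) (f g : mfps n R) :
  (forall m, fcoef f m = fcoef g m) -> f = g.
Proof. by case: f g => [f] [g] /= /funext ->. Qed.

Section Ring.
Variables (n : nat) (R : comNzRingType).
Implicit Types (f g h : mfps n R) (m : 'X_{1..n}).

Definition mfps_zero : mfps n R := MFPS (fun=> 0).
Definition mfps_opp f := MFPS (fun m => - fcoef f m).
Definition mfps_add f g := MFPS (fun m => fcoef f m + fcoef g m).

Fact mfps_addA : associative mfps_add.
Proof. by move=> f g h; apply: mfpsP => m /=; rewrite addrA. Qed.
Fact mfps_addC : commutative mfps_add.
Proof. by move=> f g; apply: mfpsP => m /=; rewrite addrC. Qed.
Fact mfps_add0 : left_id mfps_zero mfps_add.
Proof. by move=> f; apply: mfpsP => m /=; rewrite add0r. Qed.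
Fact mfps_addN : left_inverse mfps_zero mfps_opp mfps_add.
Proof. by move=> f; apply: mfpsP => m /=; rewrite addNr. Qed.

HB.instance Definition _ := GRing.isZmodule.Build (mfps n R)
  mfps_addA mfps_addC mfps_add0 mfps_addN.

Definition mfps_one : mfps n R := MFPS (fun m => (m == 0%MM)%:R).

(* The exponents k <= m all have degree < (mdeg m).+1; the bound only makes   *)
(* the index type finite.                                                     *)
Definition mfps_mul f g := MFPS (fun m =>
  \sum_(k : 'X_{1..n < (mdeg m).+1} | (k <= m)%MM)
     fcoef f k * fcoef g (m - k)%MM).

Definition mfps_trunc d f : {mpoly R[n]} :=
  \sum_(m : 'X_{1..n < d}) fcoef f m *: 'X_[m].

Lemma mcoeff_trunc d f m : (mdeg m < d)%N -> (mfps_trunc d f)@_m = fcoef f m.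
Proof. exact: mcoeff_mpoly. Qed.

Lemma mcoeffM_eq (p p' q q' : {mpoly R[n]}) m :
  (forall k, (mdeg k <= mdeg m)%N -> p@_k = p'@_k) ->
  (forall k, (mdeg k <= mdeg m)%N -> q@_k = q'@_k) ->
  (p * q)@_m = (p' * q')@_m.
Proof.
move=> Ep Eq; rewrite !mcoeffM; apply: eq_bigr => -[k1 k2] /= _.
by rewrite Ep ?Eq // -ltnS bmdeg.
Qed.

Lemma fcoef_mul_trunc f g d m : (mdeg m < d)%N ->
  fcoef (mfps_mul f g) m = (mfps_trunc d f * mfps_trunc d g)@_m.
Proof.
move=> lt_md; rewrite [RHS](mcoeff_poly_mul_lin _ _ (ltnSn (mdeg m))).
apply: eq_bigr => k _; rewrite !mcoeff_trunc //.
  by apply: leq_ltn_trans lt_md; exact: mdegB.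
by apply: leq_trans lt_md; exact: bmdeg.
Qed.

Fact mfps_mulA : associative mfps_mul.
Proof.
move=> f g h; apply: mfpsP => m; have lt_m := ltnSn (mdeg m).
rewrite !(fcoef_mul_trunc _ _ lt_m).
transitivity ((mfps_trunc (mdeg m).+1 f *
  (mfps_trunc (mdeg m).+1 g * mfps_trunc (mdeg m).+1 h))@_m).
  apply: mcoeffM_eq => // k le_km.
  by rewrite mcoeff_trunc ?ltnS // (@fcoef_mul_trunc g h (mdeg m).+1).
rewrite mulrA; apply: mcoeffM_eq => // k le_km.
by rewrite mcoeff_trunc ?ltnS // (@fcoef_mul_trunc f g (mdeg m).+1).
Qed.

Fact mfps_mulC : commutative mfps_mul.
Proof.
move=> f g; apply: mfpsP => m.
by rewrite !(fcoef_mul_trunc _ _ (ltnSn (mdeg m))) mulrC.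
Qed.

Fact mfps_mul1 : left_id mfps_one mfps_mul.
Proof.
move=> f; apply: mfpsP => m; have lt_m := ltnSn (mdeg m).
rewrite (fcoef_mul_trunc _ _ lt_m) -(mcoeff_trunc f lt_m).
rewrite -[in RHS](mul1r (mfps_trunc _ f)).
by apply: mcoeffM_eq => // k le_km; rewrite mcoeff_trunc ?ltnS // mcoeff1.
Qed.

Fact mfps_mulDl : left_distributive mfps_mul mfps_add.
Proof.
move=> f g h; apply: mfpsP => m /=; rewrite -big_split /=.
by apply: eq_bigr => k _; rewrite mulrDl.
Qed.

Fact mfps_one_neq0 : mfps_one != mfps_zero.
Proof.
apply/eqP => /(congr1 (fun f => fcoef f 0%MM)) /= /eqP.
by rewrite eqxx oner_eq0.
Qed.

HB.instance Definition _ := GRing.Zmodule_isComNzRing.Build (mfps n R)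
  mfps_mulA mfps_mulC mfps_mul1 mfps_mulDl mfps_one_neq0.

Definition mfps_scale (c : R) f := MFPS (fun m => c * fcoef f m).

Fact mfps_scaleA a b f : mfps_scale a (mfps_scale b f) = mfps_scale (a * b) f.
Proof. by apply: mfpsP => m /=; rewrite mulrA. Qed.
Fact mfps_scale1 : left_id 1 mfps_scale.
Proof. by move=> f; apply: mfpsP => m /=; rewrite mul1r. Qed.
Fact mfps_scaleDr : right_distributive mfps_scale +%R.
Proof. by move=> a f g; apply: mfpsP => m /=; rewrite mulrDr. Qed.
Fact mfps_scaleDl f : {morph mfps_scale^~ f : a b / a + b}.
Proof. by move=> a b; apply: mfpsP => m /=; rewrite mulrDl. Qed.

HB.instance Definition _ := GRing.Zmodule_isLmodule.Build R (mfps n R)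
  mfps_scaleA mfps_scale1 mfps_scaleDr mfps_scaleDl.

Fact mfps_scaleAl (a : R) f g : a *: (f * g) = (a *: f) * g.
Proof.
apply: mfpsP => m /=; rewrite mulr_sumr.
by apply: eq_bigr => k _; rewrite mulrA.
Qed.

HB.instance Definition _ := GRing.Lmodule_isLalgebra.Build R (mfps n R)
  mfps_scaleAl.
HB.instance Definition _ := GRing.Lalgebra_isComAlgebra.Build R (mfps n R).

(* Formal d/dz_i, with the coefficient formula of mpoly's mcoeff_deriv. *)
Definition fderiv (i : 'I_n) f : mfps n R :=
  MFPS (fun m => fcoef f (m + U_(i))%MM *+ (m i).+1).

Definition laplacian f : mfps n R := \sum_(i < n) fderiv i (fderiv i f).

Definition hessian f : 'M[mfps n R]_n :=
  \matrix_(i, j) fderiv i (fderiv j f).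

Definition hessian_nilpotent f : Prop := exists N : nat, hessian f ^+ N = 0.

End Ring.

Definition u (n : nat) (F : fieldType) (P : mfps n F) (k a : nat) : mfps n F :=
  (a`!%:R / (2 ^+ k * k`!%:R * (k + a)`!%:R)) *:
    iter k (@laplacian n F) (P ^+ (k + a)).

(* Main.v *)
(** Over A = C[[z]], let Q = sum_k q_k t^k solve the Hamilton-Jacobi equation
    2 dQ/dt = |grad Q|^2 with Q = P at t = 0. Along the vector field
    D = d/dt - <grad Q, grad> the Hessian H of Q satisfies D H = H^2, hence
    D (tr H^k) = k tr H^(k+1). If Hess P is nilpotent all these traces vanish
    at t = 0, so by induction on the order in t they vanish identically; in
    particular Q is harmonic. Then Lap Q^(a+1) = 2 (a+1) d(Q^a)/dt, which gives
    [t^k] Q^a = u_(k,a)(P), and the convolution identity is Q^a Q^b = Q^(a+b).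
    Power series in t are replaced by polynomials over A modulo a power of the
    variable. *)
Require Import Defs.
From HB Require Import structures.
From mathcomp Require Import all_boot all_order all_algebra.
From mathcomp Require Import mpoly.
From mathcomp Require Import boolp reals complex.
From mathcomp Require Import ring.

Set Implicit Arguments.
Unset Strict Implicit.
Unset Printing Implicit Defensive.

Import Order.TTheory GRing.Theory.
Local Open Scope ring_scope.

(** * Traces of nilpotent matrices over a domain *)

Lemma mxtrace_nilpotent (A : idomainType) (n N : nat) (M : 'M[A]_n) :
  M ^+ N = 0 -> \tr M = 0.
Proof.
case: n M => [M _|n M MN0]; first by rewrite /mxtrace big_ord0.
(* As [M ^+ N = 0], this power is the determinant of $(XI)^N-M^N$, which has the factor $XI-M$. *)
have dvd_char : char_poly M %| 'X ^+ (N * n.+1).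
  have -> : 'X ^+ (N * n.+1) = \det ('X%:M ^+ N - map_mx polyC M ^+ N).
    by rewrite -!rmorphXn /= MN0 rmorph0 subr0 det_scalar exprM.
  rewrite subrXX_comm; last exact: comm_scalar_mx.
  by rewrite -mulmxE det_mulmx dvdp_mulr // dvdpp.
(* Over a domain a divisor of a power of $X=X-0$ is associate to a power of $X$; degree and monicity
   do the rest. *)
have char_Xn : char_poly M = 'X ^+ n.+1.
  move: dvd_char; rewrite -['X]subr0 -polyC0.
  move=> /Pdiv.CommonIdomain.dvdp_exp_XsubCP[k _].
  rewrite subr0 => char_k.
  have := eqp_size char_k; rewrite size_char_poly size_polyXn => -[kE].
  apply/eqP; move: char_k.
  by rewrite -kE eqp_monic ?char_poly_monic ?monicXn.
apply: oppr_inj; rewrite oppr0 -(char_poly_trace M (ltn0Sn n)) char_Xn coefXn.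
by rewrite (ltn_eqF (ltnSn n)).
Qed.

(** * Formal power series: commuting derivations, units, integrality *)

Section FormalPowerSeries.
Variable n : nat.

Section Ring.
Variable R : comNzRingType.
Implicit Types (f g : mfps n R) (m : 'X_{1..n}) (i j : 'I_n).

Fact fderiv_is_linear i : linear (@fderiv n R i).
Proof.
by move=> c f g; apply: mfpsP => m /=; rewrite mulrnDl mulrnAr.
Qed.

HB.instance Definition _ i :=
  GRing.isLinear.Build R (mfps n R) (mfps n R) *:%R (@fderiv n R i)
    (fderiv_is_linear i).

Lemma fderivC i j f : fderiv i (fderiv j f) = fderiv j (fderiv i f).
Proof.
apply: mfpsP => m /=; rewrite -!mulrnA -!addmA [(U_(j) + _)%MM]addmC.
rewrite !mnmDE !mnm1E; case: (eqVneq i j) => [->//|ne_ij].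
by rewrite !addn0 mulnC.
Qed.

(** Transferred from polynomials by truncation. A derivative at [m] reads coefficients of degree
    [mdeg m + 1], hence the bound [(mdeg m).+2]. *)
Lemma fderivM i f g : fderiv i (f * g) = fderiv i f * g + f * fderiv i g.
Proof.
apply: mfpsP => m; set d := (mdeg m).+2.
have trunc_deriv (h : mfps n R) k : (mdeg k <= mdeg m)%N ->
    (mderiv i (mfps_trunc d h))@_k = fcoef (fderiv i h) k.
  by move=> le_km; rewrite mcoeff_deriv mcoeff_trunc // mdegD mdeg1 addn1 !ltnS.
have mulE (h1 h2 : mfps n R) : fcoef (h1 * h2) m =
    (mfps_trunc d h1 * mfps_trunc d h2)@_m.
  exact: fcoef_mul_trunc.
rewrite -[RHS]/(fcoef (fderiv i f * g) m + fcoef (f * fderiv i g) m).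
have -> : fcoef (fderiv i (f * g)) m =
    (mderiv i (mfps_trunc d f * mfps_trunc d g))@_m.
  rewrite mcoeff_deriv -fcoef_mul_trunc //.
  by rewrite mdegD mdeg1 addn1.
rewrite mderivM mcoeffD.
congr (_ + _).
  rewrite mulE; apply: mcoeffM_eq => // k le_km.
  by rewrite trunc_deriv // mcoeff_trunc // ltnS ltnW.
rewrite mulE; apply: mcoeffM_eq => // k le_km.
by rewrite trunc_deriv // mcoeff_trunc // ltnS ltnW.
Qed.

(** An [idomainType] carries an inverse, chosen classically here, so that [mxtrace_nilpotent] can be
    applied to matrices of series. *)
Definition mfps_unit : {pred mfps n R} := fun f => `[< exists g, g * f = 1 >].

Definition mfps_inv f : mfps n R :=
  if pselect (exists g, g * f = 1) is left ex_inv then sval (cid ex_inv) else f.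

Fact mfps_mulVr : {in mfps_unit, left_inverse 1 mfps_inv *%R}.
Proof.
move=> f /asboolP Uf; rewrite /mfps_inv; case: pselect => // ex_inv.
exact: svalP (cid ex_inv).
Qed.

Fact mfps_unitPl f g : g * f = 1 -> mfps_unit f.
Proof. by move=> gf1; apply/asboolP; exists g. Qed.

Fact mfps_invr_out : {in [predC mfps_unit], mfps_inv =1 id}.
Proof.
move=> f /asboolPn nUf; rewrite /mfps_inv; case: pselect => // ex_inv.
Qed.

HB.instance Definition _ := GRing.ComNzRing_hasMulInverse.Build (mfps n R)
  mfps_mulVr mfps_unitPl mfps_invr_out.

End Ring.

Section Domain.
Variable R : idomainType.
Implicit Types f g : mfps n R.

Lemma mfps_least_exponent f : f != 0 ->
  exists2 m, fcoef f m != 0 & forall k, (k < m)%O -> fcoef f k = 0.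
Proof.
move=> nzf; apply: contrapT => no_least; case/eqP: nzf; apply: mfpsP => m.
elim/(@ltmwf n): m => m IHm; apply/eqP/negPn/negP => nz_m.
by apply: no_least; exists m.
Qed.

(* The least exponents of f and g for a monomial order add up. *)
Fact mfps_mulf_eq0 f g : f * g = 0 -> (f == 0) || (g == 0).
Proof.
apply: contra_eqT; rewrite negb_or => /andP[nzf nzg].
have [a nz_a lt_a] := mfps_least_exponent nzf.
have [b nz_b lt_b] := mfps_least_exponent nzg.
apply/eqP => /(congr1 (fun h => fcoef h (a + b)%MM)) /=.
have lt_ab : (mdeg a < (mdeg (a + b)%MM).+1)%N by rewrite mdegD ltnS leq_addr.
rewrite (bigD1 (BMultinom lt_ab)) /=; last by rewrite lem_addr.
rewrite big1 => [|k /andP[le_k ne_k]].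
  have -> : (a + b - a)%MM = b by rewrite addmC addmK.
  rewrite addr0 => /eqP.
  by rewrite mulf_eq0 (negPf nz_a) (negPf nz_b).
(* If [k < a], the coefficient of [f] vanishes; if [a < k], then [a + b - k < b] and that of [g]
   does. *)
have: bmnm k != a by apply: contra ne_k => /eqP k_a; apply/eqP/val_inj.
rewrite neq_lt => /orP[/lt_a->|lt_ak]; first by rewrite mul0r.
rewrite [X in _ * X]lt_b ?mulr0 //.
by rewrite -(ltmc_add2r k) addmC submK // ltmc_add2l.
Qed.

HB.instance Definition _ := GRing.ComUnitRing_isIntegral.Build (mfps n R)
  mfps_mulf_eq0.

End Domain.
End FormalPowerSeries.

Lemma hessian_nilpotent_mxtrace (n : nat) (R : idomainType) (P : mfps n R) k :
  hessian_nilpotent P -> \tr (hessian P ^+ k.+1) = 0.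
Proof.
case=> N HN0; apply: (@mxtrace_nilpotent _ _ N).
by rewrite exprAC HN0 expr0n.
Qed.

(** * Congruence of polynomials modulo a power of the variable *)

Section CongruenceModXn.
Variable A : comNzRingType.
Implicit Types (p q r s : {poly A}) (M : nat).

Definition eq_modX M p q := forall j, (j < M)%N -> p`_j = q`_j.

Lemma eq_modX_trans M p q r : eq_modX M p q -> eq_modX M q r -> eq_modX M p r.
Proof. by move=> pq qr j ltjM; rewrite pq ?qr. Qed.

Lemma eq_modXW M p q : eq_modX M.+1 p q -> eq_modX M p q.
Proof. by move=> pq j ltjM; apply: pq; rewrite ltnS ltnW. Qed.

Lemma eq_modXD M p q r s :
  eq_modX M p q -> eq_modX M r s -> eq_modX M (p + r) (q + s).
Proof. by move=> pq rs j ltjM; rewrite !coefD pq ?rs. Qed.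

Lemma eq_modXMn M k p q : eq_modX M p q -> eq_modX M (p *+ k) (q *+ k).
Proof. by move=> pq j ltjM; rewrite !coefMn pq. Qed.

Lemma eq_modXM M p q r s :
  eq_modX M p q -> eq_modX M r s -> eq_modX M (p * r) (q * s).
Proof.
move=> pq rs j ltjM; rewrite !coefM; apply: eq_bigr => -[i /= le_ij] _.
by rewrite pq ?rs // (leq_ltn_trans _ ltjM) // leq_subr.
Qed.

Lemma eq_modX_sum M (I : finType) (p q : I -> {poly A}) :
  (forall i, eq_modX M (p i) (q i)) -> eq_modX M (\sum_i p i) (\sum_i q i).
Proof. by move=> pq j ltjM; rewrite !coef_sum; apply: eq_bigr => i _; apply: pq. Qed.

End CongruenceModXn.

(** * The Hamilton-Jacobi flow over an algebra with commuting derivations *)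

Section HamiltonJacobi.
Variables (F : fieldType) (A : comAlgType F) (n : nat).
Variable d : 'I_n -> {linear A -> A}.
Hypothesis pcharF : [pchar F] =i pred0.
Hypothesis dM : forall i (x y : A), d i (x * y) = (d i x : A) * y + x * (d i y : A).
Hypothesis dC : forall i j x, d i (d j x) = d j (d i x).

Implicit Types (x : A) (p q Q : {poly A}) (i j : 'I_n).

Let D i p : {poly A} := map_poly (d i) p.

Let coef_D i p k : (D i p)`_k = d i p`_k.
Proof. by rewrite coef_map_id0 ?raddf0. Qed.

Let D_sum i (I : finType) (p : I -> {poly A}) :
  D i (\sum_k p k) = \sum_k D i (p k).
Proof. exact: raddf_sum. Qed.

Let D_muln i p k : D i (p *+ k) = D i p *+ k.
Proof. exact: raddfMn. Qed.

Let D_mul i p q : D i (p * q) = D i p * q + p * D i q.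
Proof.
apply/polyP => k; rewrite coef_D coefM linear_sum coefD.
rewrite !coefM -big_split; apply: eq_bigr => j _.
by rewrite dM !coef_D.
Qed.

Let D_exp i p k : D i (p ^+ k) = p ^+ k.-1 * D i p *+ k.
Proof.
elim: k => [|k IHk].
  rewrite mulr0n; apply/polyP => k; rewrite coef_D expr0 coef1 coef0.
  have d1 : d i 1 = 0.
    by apply: (addIr (d i 1)); rewrite add0r -{3}(mulr1 1) dM mulr1 mul1r.
  by case: (k == 0)%N; rewrite ?d1 ?raddf0.
rewrite exprS D_mul IHk /=; case: k {IHk} => [|k]; rewrite /= ?mulr1n ?mulr0n ?mulr0.
  by rewrite expr0 addr0 mulr1 mul1r.
by rewrite exprS; ring.
Qed.

Let D_comm i j p : D i (D j p) = D j (D i p).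
Proof. by apply/polyP => k; rewrite !coef_D dC. Qed.

Let D_deriv i p : D i p^`() = (D i p)^`().
Proof. by apply/polyP => k; rewrite !(coef_D, coef_deriv) raddfMn. Qed.

Let D_eq_modX M i p q : eq_modX M p q -> eq_modX M (D i p) (D i q).
Proof. by move=> pq k ltkM; rewrite !coef_D pq. Qed.

Let grad2 Q := \sum_i D i Q ^+ 2.

Let grad2_eq_modX M p q : eq_modX M p q -> eq_modX M (grad2 p) (grad2 q).
Proof.
move=> pq; apply: eq_modX_sum => i; rewrite !expr2.
by apply: eq_modXM; apply: D_eq_modX.
Qed.

Lemma natf_neq0 k : (0 < k)%N -> (k%:R : F) != 0.
Proof. by rewrite ((pcharf0P F).1 pcharF) lt0n. Qed.

Lemma mulrSn_inj (V : lmodType F) k : injective (fun x : V => x *+ k.+1).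
Proof.
by move=> x y /=; rewrite -!scaler_nat; apply: scalerI; apply: natf_neq0.
Qed.

(* Picard iteration: integrating the right-hand side gains one power of X. *)
Lemma hamilton_jacobi_solution x M :
  exists2 Q : {poly A}, Q`_0 = x & eq_modX M (Q^`() *+ 2) (grad2 Q).
Proof.
pose T Q : {poly A} := \poly_(k < (size (grad2 Q)).+1)
  (if k is l.+1 then (2 * l.+1)%:R^-1 *: (grad2 Q)`_l else x).
have T0 Q : (T Q)`_0 = x by rewrite coef_poly.
have TS Q l : (T Q)`_l.+1 = (2 * l.+1)%:R^-1 *: (grad2 Q)`_l.
  rewrite coef_poly ltnS; case: ltnP => // le_l.
  by rewrite nth_default // scaler0.
have T_contract l p q : eq_modX l p q -> eq_modX l.+1 (T p) (T q).
  move=> pq [_|k lt_k]; first by rewrite !T0.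
  by rewrite !TS (grad2_eq_modX pq).
have T_iter l : eq_modX l (iter l T 0) (iter l.+1 T 0).
  by elim: l => // l IHl; rewrite iterS; apply: T_contract.
(* Twice the derivative of iterate [M.+1] is exactly [grad2] of iterate [M], and the two iterates
   agree below order [M]. *)
exists (iter M.+1 T 0); first exact: T0.
apply: (@eq_modX_trans _ _ _ (grad2 (iter M T 0))); last first.
  by apply: grad2_eq_modX; apply: T_iter.
move=> k _; rewrite iterS coefMn coef_deriv TS -mulrnA muln2 -mul2n -scaler_nat.
by rewrite scalerA divff ?scale1r // natf_neq0.
Qed.

Section Solution.
Variables (M : nat) (Q : {poly A}).
Hypothesis hjQ : eq_modX M (Q^`() *+ 2) (grad2 Q).

Let H : 'M[{poly A}]_n := \matrix_(i, j) D i (D j Q).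

(** The vector field called D in the opening comment; [D i] is the spatial derivative, acting on
    coefficients. *)
Let Dt p : {poly A} := p^`() - \sum_i D i Q * D i p.

Let Dt_sum (I : finType) (p : I -> {poly A}) : Dt (\sum_k p k) = \sum_k Dt (p k).
Proof.
rewrite /Dt linear_sum sumrB exchange_big; congr (_ - _).
by apply: eq_bigr => i _; rewrite D_sum mulr_sumr.
Qed.

Let Dt_mul p q : Dt (p * q) = Dt p * q + p * Dt q.
Proof.
rewrite /Dt derivM mulrBl mulrBr addrACA; congr (_ + _).
rewrite -opprD mulr_suml mulr_sumr -big_split; congr (- _).
by apply: eq_bigr => i _; rewrite D_mul /=; ring.
Qed.

(** Apply $\partial_i\partial_j$ to $2Q'=|\nabla Q|^2$: the third derivatives of $Q$ form the
    transport term of [Dt], the products of second derivatives give $2H^2$. The factor 2 cancels in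
    characteristic 0. *)
Let Dt_hessian i j : eq_modX M (Dt (H i j)) ((H *m H) i j).
Proof.
move=> k ltkM; apply: (@mulrSn_inj A 1); rewrite -!coefMn /=.
move: k ltkM.
have HQ : eq_modX M (D i (D j (Q^`() *+ 2))) (D i (D j (grad2 Q))).
  by do 2!apply: D_eq_modX.
rewrite -/(eq_modX M _ _).
have -> : Dt (H i j) *+ 2 = D i (D j (Q^`() *+ 2)) - (\sum_k D k Q * D k (H i j)) *+ 2.
  by rewrite /Dt mulrnBl !D_muln !D_deriv mxE.
have -> : (H *m H) i j *+ 2 = D i (D j (grad2 Q)) - (\sum_k D k Q * D k (H i j)) *+ 2.
  apply/eqP; rewrite -subr_eq opprK; apply/eqP.
  rewrite mxE -mulrnDl -big_split -sumrMnl /grad2 !D_sum.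
  apply: eq_bigr => k _; rewrite !mxE D_exp /= expr1 D_muln D_mul.
  rewrite (D_comm j k) (D_comm i k (D j Q)) (D_comm k j) (D_comm k i (D j Q)).
  by ring.
by move=> k ltkM; rewrite !coefB HQ.
Qed.

(** Working with entries rather than traces lets the Leibniz rule split off one factor [H] at a
    time. *)
Let Dt_hessian_exp k i j :
  eq_modX M (Dt ((H ^+ k.+1) i j)) ((H ^+ k.+2) i j *+ k.+1).
Proof.
elim: k i j => [|k IHk] i j.
  by rewrite expr1 expr2 mulr1n; apply: Dt_hessian.
rewrite exprS mxE Dt_sum [H ^+ k.+3]exprS.
have -> : (H * H ^+ k.+2) i j *+ k.+2 =
  \sum_l ((H *m H) i l * (H ^+ k.+1) l j + H i l * ((H ^+ k.+2) l j *+ k.+1)).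
  rewrite mulrS; apply/esym; rewrite big_split; congr (_ + _).
    by rewrite [H ^+ k.+2]exprS mulrA !mulmxE mxE.
  by rewrite mxE -sumrMnl; apply: eq_bigr => l _; rewrite mulrnAr.
apply: eq_modX_sum => l; rewrite Dt_mul; apply: eq_modXD.
  by apply: eq_modXM => //; apply: Dt_hessian.
by apply: eq_modXM.
Qed.

Hypothesis trQ0 : forall k, (\tr (H ^+ k.+1))`_0 = 0.

(** Induction on the order, for all [k] at once: order [j.+1] of one trace is determined by its own
    lower orders and by order [j] of the next trace. Integration in t gains one order, hence
    [M.+1]. *)
Lemma mxtrace_hessian_flow k : eq_modX M.+1 (\tr (H ^+ k.+1)) 0.
Proof.
move=> j; rewrite ltnS coef0; elim/ltn_ind: j k => -[|j] IHj k ltjM //.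
have /(_ j ltjM) : eq_modX M (Dt (\tr (H ^+ k.+1))) (\tr (H ^+ k.+2) *+ k.+1).
  by rewrite /mxtrace Dt_sum -sumrMnl; apply: eq_modX_sum => i; apply: Dt_hessian_exp.
rewrite coefMn IHj ?mul0rn ?(ltnW ltjM) // /Dt coefB coef_sum.
rewrite big1 ?subr0 => [|i _].
  rewrite coef_deriv => tr0; apply: (@mulrSn_inj A j).
  by rewrite /= tr0 mul0rn.
rewrite coefM big1 // => -[l /= le_lj] _.
rewrite [X in _ * X]coef_D IHj ?raddf0 ?mulr0 //.
  by rewrite ltnS leq_subr.
by rewrite (leq_trans _ (ltnW ltjM)) // leq_subr.
Qed.

(** Here $\Delta Q^{k+1}=(k+1)(Q^k\Delta Q+kQ^{k-1}|\nabla Q|^2)$, where $\Delta Q=\mathrm{tr}\,H$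
    vanishes and $|\nabla Q|^2$ is $2Q'$, modulo $X^M$. *)
Lemma laplacian_exp_flow k :
  eq_modX M (\sum_i D i (D i (Q ^+ k.+1))) ((Q ^+ k)^`() *+ (2 * k.+1)).
Proof.
have lapQ0 : eq_modX M (\sum_i D i (D i Q)) 0.
  apply: eq_modXW; have := mxtrace_hessian_flow 0; rewrite expr1 /mxtrace.
  by under eq_bigr do rewrite mxE.
(* At [k = 0] the truncated exponent [k.-1] is harmless, since its term is multiplied by [k]. *)
have -> : \sum_i D i (D i (Q ^+ k.+1)) =
    (Q ^+ k * (\sum_i D i (D i Q)) + (Q ^+ k.-1 * grad2 Q) *+ k) *+ k.+1.
  rewrite /grad2 !mulr_sumr -sumrMnl -big_split -sumrMnl.
  apply: eq_bigr => i _; rewrite D_exp D_muln D_mul D_exp /=.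
  by rewrite addrC expr2 mulrA mulrnAl.
have -> : (Q ^+ k)^`() *+ (2 * k.+1) =
    (Q ^+ k * 0 + (Q ^+ k.-1 * (Q^`() *+ 2)) *+ k) *+ k.+1.
  by rewrite mulr0 add0r deriv_exp; ring.
apply: eq_modXMn; apply: eq_modXD; first exact: eq_modXM.
by apply: eq_modXMn; apply: eq_modXM => // j /hjQ.
Qed.

End Solution.

Let lap x : A := \sum_i d i (d i x).

Let lapZ c x : lap (c *: x) = c *: lap x.
Proof. by rewrite /lap scaler_sumr; apply: eq_bigr => i _; rewrite !linearZ. Qed.

Definition flow_coef x k a : A :=
  (a`!%:R / (2 ^+ k * k`!%:R * (k + a)`!%:R)) *: iter k lap (x ^+ (k + a)).

(** The same recursion that [laplacian_exp_flow] gives for the coefficients of the powers of [Q];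
    [k.+1] is the factor produced by d/dt. *)
Lemma lap_flow_coef x k a :
  lap (flow_coef x k a.+1) = flow_coef x k.+1 a *+ k.+1 *+ (2 * a.+1).
Proof.
rewrite /flow_coef lapZ -!scaler_nat !scalerA addSnnS iterS; congr (_ *: _).
rewrite !factS !natrM exprS.
by field; rewrite nat1r expf_neq0 ?natf_neq0 ?fact_gt0.
Qed.

Variable x : A.
Hypothesis trx0 : forall k, \tr ((\matrix_(i, j) d i (d j x) : 'M[A]_n) ^+ k.+1) = 0.

(** Induction on [k] for all [a] at once: order [k.+1] of [Q ^+ a] comes from order [k] of
    [Q ^+ a.+1]. *)
Lemma flow_coefP M : exists Q : {poly A},
  forall k a, (k <= M)%N -> (Q ^+ a)`_k = flow_coef x k a.
Proof.
have [Q Q0 hjQ] := hamilton_jacobi_solution x M.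
pose H : 'M[{poly A}]_n := \matrix_(i, j) D i (D j Q).
(* The constant coefficient is evaluation at 0, a ring morphism, so it passes through trace and
   power. *)
have trQ0 k : (\tr (H ^+ k.+1))`_0 = 0.
  rewrite -horner_coef0 -[LHS]/(horner_eval 0 _) -trace_map_mx rmorphXn /=.
  rewrite -[RHS](trx0 k); congr (\tr (_ ^+ _)); apply/matrixP => i j.
  by rewrite !mxE /horner_eval horner_coef0 !coef_D Q0.
exists Q; elim=> [|k IHk] a lekM.
  rewrite -horner_coef0 horner_exp horner_coef0 Q0 /flow_coef add0n fact0.
  by rewrite expr0 !mul1r divff ?scale1r // natf_neq0 ?fact_gt0.
have := laplacian_exp_flow hjQ trQ0 a lekM.
rewrite coef_sum coefMn coef_deriv.
under eq_bigr do rewrite !coef_D IHk ?(ltnW lekM) //.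
rewrite -/(lap _) lap_flow_coef mul2n doubleS => /mulrSn_inj/mulrSn_inj.
by move->.
Qed.

Lemma flow_coef_convolution m a b :
  flow_coef x m (a + b) = \sum_(k < m.+1) flow_coef x k a * flow_coef x (m - k) b.
Proof.
have [Q QE] := flow_coefP m.
rewrite -QE // exprD coefM; apply: eq_bigr => -[k /= lekm] _.
by rewrite !QE // leq_subr.
Qed.

End HamiltonJacobi.

(** * Normalising scalars as binomials, and the conclusion over $\mathbb{C}$ *)

Lemma flow_scalars_binomial (F : fieldType) (a b k l : nat) :
    [pchar F] =i pred0 ->
  ((a + b)`!%:R / (2 ^+ (k + l) * (k + l)`!%:R * (k + l + (a + b))`!%:R))^-1 *
    (a`!%:R / (2 ^+ k * k`!%:R * (k + a)`!%:R) *
     (b`!%:R / (2 ^+ l * l`!%:R * (l + b)`!%:R))) =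
  'C(a + b, a)%:R^-1 * ('C(k + l, k) * 'C(k + l + a + b, k + a))%:R :> F.
Proof.
move=> pcharF; have nz j : (0 < j)%N -> j%:R != 0 :> F := @natf_neq0 F pcharF j.
have binE i j : 'C(i + j, i)%:R = (i + j)`!%:R / (i`!%:R * j`!%:R) :> F.
  rewrite -(bin_fact (leq_addr j i)) addKn !natrM mulfK //.
  by rewrite -natrM nz // muln_gt0 !fact_gt0.
have -> : (k + l + a + b = k + a + (l + b))%N by ring.
rewrite natrM !binE exprD addnACA.
by field; rewrite !expf_neq0 ?nz ?fact_gt0.
Qed.

Theorem proposition6p1 (R : realType) (n : nat) (P : mfps n R[i])
    (hP : hessian_nilpotent P) (a b m : nat) (ha : (1 <= a)%N) (hb : (1 <= b)%N) :
  u P m (a + b) = \sum_(k < m.+1) u P k a * u P (m - k) b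
  /\
  iter m (@laplacian n R[i]) (P ^+ (m + a + b)) =
    ('C(a + b, a)%:R)^-1 *:
      \sum_(k < m.+1) ('C(m, k) * 'C(m + a + b, k + a))%:R *:
        (iter k (@laplacian n R[i]) (P ^+ (k + a)) *
         iter (m - k) (@laplacian n R[i]) (P ^+ (m - k + b))).
Proof.
have pchar0 : [pchar R[i]] =i pred0 by apply: Num.Theory.pchar_num.
have nz j : (0 < j)%N -> j%:R != 0 :> R[i] := @natf_neq0 _ pchar0 j.
have conv : u P m (a + b) = \sum_(k < m.+1) u P k a * u P (m - k) b.
  (* For the derivations [fderiv i], [flow_coef] unfolds to the same term as [u]. *)
  apply: (flow_coef_convolution (d := fun i => @fderiv n R[i] i) pchar0).
  - exact: fderivM.
  - exact: fderivC.
  - by move=> k; apply: hessian_nilpotent_mxtrace.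
split=> //.
(* The scalar in [u P m (a + b)]; dividing the convolution identity by it gives the explicit
   form. *)
set c := (a + b)`!%:R / (2 ^+ m * m`!%:R * (m + (a + b))`!%:R) : R[i].
have nzc : c != 0 by rewrite !(mulf_neq0, invr_neq0, expf_neq0) ?nz ?fact_gt0.
rewrite -addnA -[LHS](scalerK nzc) -/(u P m (a + b)) conv !scaler_sumr addnA.
apply: eq_bigr => -[k /=]; rewrite ltnS => lekm _.
rewrite /u -scalerAl -scalerAr !scalerA; congr (_ *: _).
(* Writing [m] as [k + l] removes the truncated subtraction. *)
rewrite /c; move: (m - k)%N (subnKC lekm) => l <-.
by rewrite -mulrA flow_scalars_binomial.
Qed.
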